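(* Let $\nu$ be a $\sigma$-finite measure and let $F_n=\{f_1,\ldots,f_{M_n}\}$ be functions with $\|f_j\|_{L^2(\nu)}\le 1$ for $1\le j\le M_n$. (i) For $0<q\le 1$ there exists a positive constant $c_q$ depending only on $q$ such that for any $0<\epsilon<t_n$, the class $\mathcal{F}_q(t_n)$ contains an $\epsilon$-net $\{e_j\}_{j=1}^{N_\epsilon}$ in the $L_2(\nu)$ distance with $\|e_j\|_0\le 5(t_n\epsilon^{-1})^{2q/(2-q)}+1$ for $j=1,\ldots,N_\epsilon$, where $N_\epsilon$ satisfies $$\log N_\epsilon\le\begin{cases} c_q\,(t_n\epsilon^{-1})^{\frac{2q}{2-q}}\log\bigl(1+M_n^{\frac1q-\frac12}t_n^{-1}\epsilon\bigr) & \text{if } \epsilon>t_nM_n^{\frac12-\frac1q},\\ c_q\,M_n\log\bigl(1+M_n^{\frac12-\frac1q}t_n\epsilon^{-1}\bigr) & \text{if } \epsilon\le t_nM_n^{\frac12-\frac1q}.\end{cases}$$ (ii) For any $1\le m\le M_n$, $0<q\le 1$, $t_n>0$ (and any $f_0\in L^2(\nu)$), there exist a subset $J_m\subset\{1,\ldots,M_n\}$ of size $m$ and $f_{\theta^m}\in\mathcal{F}_{J_m}$ with $\|\theta^m\|_1\le t_n$ such that $$\|f_{\theta^m}-f_0\|^2-d^2(f_0;\mathcal{F}_q(t_n))\le 2^{2/q-1}t_n^2m^{1-2/q}.$$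
   Context: $M_n\ge 2$ is an integer and $t_n>0$. For $\theta\in\mathbb{R}^{M_n}$, $\|\theta\|_0=\sum_j I(\theta_j\ne 0)$ and $\|\theta\|_q=(\sum_j|\theta_j|^q)^{1/q}$ for $0<q\le 1$. Put $f_\theta=\sum_{j=1}^{M_n}\theta_jf_j$ and $\mathcal{F}_q(t_n)=\{f_\theta:\|\theta\|_q\le t_n\}$. For a linear combination $e=f_\theta$, $\|e\|_0$ denotes the number of nonzero coefficients in its representation, $\|\theta\|_0$. For $J_m\subset\{1,\ldots,M_n\}$ of size $m$, $\mathcal{F}_{J_m}=\{\sum_{j\in J_m}\theta_jf_j:\theta\in\mathbb{R}^m\}$. $d^2(f_0;\mathcal{F})=\inf_{f\in\mathcal{F}}\|f-f_0\|^2$, where $\|\cdot\|$ is the $L^2(\nu)$ norm. *)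

(* Defs.v *)
From HB Require Import structures.
From mathcomp Require Import all_boot all_order all_algebra.
From mathcomp Require Import all_classical all_reals all_analysis.
Set Implicit Arguments.
Unset Strict Implicit.
Unset Printing Implicit Defensive.
Import Order.TTheory GRing.Theory Num.Theory.
Import numFieldNormedType.Exports.
Local Open Scope classical_set_scope.
Local Open Scope ring_scope.

Definition l0norm (R : realType) (M : nat) (theta : 'rV[R]_M) : nat :=
  (\sum_(j < M) (theta ord0 j != 0%R))%N.

(* Since [0 `^ q = 0] only for q <> 0, this is meant for q > 0; it is a norm
   for q = 1 and a quasi-norm for 0 < q < 1 *)
Definition lqnorm (R : realType) (q : R) (M : nat) (theta : 'rV[R]_M) : R :=
  (\sum_(j < M) `|theta ord0 j| `^ q) `^ q^-1.

Definition lincomb (R : realType) (T : Type) (M : nat) (f : 'I_M -> T -> R)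
    (theta : 'rV[R]_M) : T -> R :=
  fun x => \sum_(j < M) theta ord0 j * f j x.

Definition lqhull (R : realType) (T : Type) (M : nat) (f : 'I_M -> T -> R)
    (q t : R) : set (T -> R) :=
  lincomb f @` [set theta : 'rV[R]_M | lqnorm q theta <= t].

(* [fine] sends an infinite norm to 0: only meaningful on [Lfun nu 2%:E] *)
Definition L2norm (d : measure_display) (T : measurableType d) (R : realType)
    (nu : {measure set T -> \bar R}) (g : T -> R) : R :=
  fine ('N[nu]_(2%:E) [EFin \o g])%E.

Definition dist2 (d : measure_display) (T : measurableType d) (R : realType)
    (nu : {measure set T -> \bar R}) (g : T -> R) (F : set (T -> R)) : R :=
  inf [set L2norm nu (h \- g) ^+ 2 | h in F].

(* An internal net: its points are required to lie in F *)
Definition is_eps_net (d : measure_display) (T : measurableType d)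
    (R : realType) (nu : {measure set T -> \bar R}) (F : set (T -> R))
    (eps : R) (N : nat) (e : 'I_N -> T -> R) : Prop :=
  (forall i, F (e i)) /\
  (forall g, F g -> exists i, L2norm nu (g \- e i) <= eps).

(* The coefficient vectors of the elements of F_J: a vector indexed by J is
   extended by zero outside of J *)
Definition supported_in (R : realType) (M : nat) (J : {set 'I_M})
    (theta : 'rV[R]_M) : Prop :=
  forall j, j \notin J -> theta ord0 j = 0.

(* Main.v *)
Require Import Defs.
From HB Require Import structures.
From mathcomp Require Import all_boot all_order all_algebra.
From mathcomp Require Import all_classical all_reals all_analysis.
From mathcomp Require Import ring lra zify.
Set Implicit Arguments.
Unset Strict Implicit.
Unset Printing Implicit Defensive.
Import Order.TTheory GRing.Theory Num.Theory.
Import numFieldNormedType.Exports.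
Local Open Scope classical_set_scope.
Local Open Scope ring_scope.

(** Fix the dictionary f_1, ..., f_M and write N(theta) for the L2 norm of
    f_theta.  Apart from the triangle inequality, two features of N matter:
    it is at most |a| on a multiple a e_j of a basis vector, and its square,
    as well as theta |-> ||f_theta - f_0||^2, is quadratic.  For such a
    function, averaging over random directions v of mean x costs only the
    second order term, because the first order term at y is linear in v.

    Maurey's argument follows (lemma [maurey]).  If ||x||_1 <= L, then x is
    the mean of n independent draws of 0 or of +-(L/n) e_j, and the expected
    squared loss of this sampling is at most L^2/n; hence some outcome does at
    least as well.  The draws are chosen one at a time, each of them by
    averaging over finitely many possibilities.

    All approximations come from it by thresholding.  If sum_j |theta_j|^q is
    at most t^q, then the coefficients below tau have total mass at most
    tau^(1-q) t^q, and fewer than (t/tau)^q coefficients exceed tau.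

    Part (ii): with a = (m-1)/2 rounded down, keep the coefficients larger than
    t (a+1)^(-1/q), at most a of them, and sample the others m - a times
    ([sparse_risk]).  For this split the error is strictly below the claimed
    one ([sparse_risk_bound]), and the margin absorbs the fact that the infimum
    over the l_q ball is only approached.

    Part (i) combines three facts, with s = t/eps and K = s^(2q/(2-q)).
    First, every point of the ball is within 2 eps/3 of a point of the ball
    with at most 5K nonzero coefficients ([sparse_in_ball]): sampling the small
    coefficients in steps of size at least tau does not increase
    sum_j |theta_j|^q, so the number of nonzero coefficients is bounded by
    (t/tau)^q.
    Secondly, the ball has a cover at scale eps/6 of the required cardinality
    ([entropy_sparse], [entropy_dense]).  A vector is rounded to a grid, and
    the remainder is sampled; the number of centres is then bounded by counting
    the nonnegative integer vectors z with sum_j z_j^q <= K, of which there are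
    at most exp (K (1 + C + log (1 + M/K))) with C depending only on q
    ([count_nat_vectors]).
    Thirdly, a cover by arbitrary centres becomes a net made of sparse points
    of the ball: pick a sparse point in each cell that contains one
    ([exists_sparse_net]); the error is 2 eps/3 + 2 eps/6 = eps. *)

(** * The L2 norm of linear combinations *)

Lemma le1_2e (R : realType) : (1 <= 2%:E :> \bar R)%E.
Proof. by rewrite lee1n. Qed.

Section L2.
Context (R : realType) (d : measure_display) (T : measurableType d).
Variable nu : {measure set T -> \bar R}.
Implicit Types g h : T -> R.

Lemma L2norm_ge0 g : 0 <= L2norm nu g.
Proof. exact/fine_ge0/Lnorm_ge0. Qed.

Lemma L2norm_sqr g : L2norm nu g ^+ 2 = (\int[nu]_x (g x ^+ 2))%R.
Proof.
rewrite -powR_mulrn ?L2norm_ge0// /L2norm -fine_poweR powR_Lnorm ?pnatr_eq0//.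
rewrite /Rintegral; congr fine; apply: eq_integral => x _ /=.
by rewrite powR_mulrn// -normrX ger0_norm// sqr_ge0.
Qed.

Lemma Lfun2_add g h : g \in Lfun nu 2%:E -> h \in Lfun nu 2%:E ->
  g \+ h \in Lfun nu 2%:E.
Proof. by move=> ? ?; exact: (proj2 (Lfun_addr_closed nu (le1_2e R))). Qed.

Lemma Lfun2_sub g h : g \in Lfun nu 2%:E -> h \in Lfun nu 2%:E ->
  g \- h \in Lfun nu 2%:E.
Proof.
move=> gP hP; apply: Lfun2_add => //.
exact: (Lfun_oppr_closed hP).
Qed.

Lemma L2norm_add g h : g \in Lfun nu 2%:E -> h \in Lfun nu 2%:E ->
  L2norm nu (g \+ h) <= L2norm nu g + L2norm nu h.
Proof.
move=> gP hP.
exact: (ler_LnormD (Lfun_Sub (le1_2e R) gP) (Lfun_Sub (le1_2e R) hP)).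
Qed.

Lemma integrable_mul g h : g \in Lfun nu 2%:E -> h \in Lfun nu 2%:E ->
  nu.-integrable setT (EFin \o (g \* h)).
Proof. by move=> ? ?; apply/Lfun1_integrable; exact: Lfun2_mul_Lfun1. Qed.

Lemma Rintegral_lincomb (I : Type) (s : seq I) (a : I -> R) (u : I -> T -> R) :
  (forall i, nu.-integrable setT (EFin \o u i)) ->
  nu.-integrable setT (EFin \o (fun x => \sum_(i <- s) a i * u i x)) /\
  (\int[nu]_x (\sum_(i <- s) a i * u i x))%R =
  \sum_(i <- s) a i * (\int[nu]_x u i x)%R.
Proof.
move=> ui; elim: s => [|i s [IH1 IH2]].
  under eq_fun do rewrite big_nil; rewrite big_nil; split.
    exact: (integrable0 nu).
  rewrite Rintegral_cst//; rewrite mul0r//.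
have aui : nu.-integrable setT (EFin \o (fun x => a i * u i x)).
  exact: (integrableZl measurableT (a i) (ui i)).
split.
  under eq_fun do rewrite big_cons.
  exact: (integrableD measurableT aui IH1).
rewrite big_cons -IH2; under eq_Rintegral do rewrite big_cons.
by rewrite RintegralD//; congr (_ + _); rewrite RintegralZl.
Qed.

Variables (M : nat) (f : 'I_M -> T -> R).
Hypothesis fL2 : forall j, f j \in Lfun nu 2%:E.

Lemma lincombD (x y : 'rV[R]_M) :
  lincomb f (x + y) = lincomb f x \+ lincomb f y.
Proof.
apply/funext => t; rewrite /lincomb /= -big_split /=.
by apply: eq_bigr => j _; rewrite mxE mulrDl.
Qed.

Lemma lincombN (x : 'rV[R]_M) : lincomb f (- x) = \- lincomb f x.
Proof.
apply/funext => t; rewrite /lincomb /= -sumrN.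
by apply: eq_bigr => j _; rewrite mxE mulNr.
Qed.

Lemma lincombB (x y : 'rV[R]_M) :
  lincomb f (x - y) = lincomb f x \- lincomb f y.
Proof. by rewrite lincombD lincombN. Qed.

Lemma lincomb_scale_delta (a : R) j : lincomb f (a *: delta_mx 0 j) = a \*o f j.
Proof.
apply/funext => t; rewrite /lincomb (bigD1 j)//= big1 ?addr0.
  by rewrite !mxE !eqxx mulr1.
by move=> i ij; rewrite !mxE (negbTE ij) andbF mulr0 mul0r.
Qed.

Lemma lincomb_L2 (x : 'rV[R]_M) : lincomb f x \in Lfun nu 2%:E.
Proof.
rewrite (_ : lincomb f x = \sum_(j < M) x ord0 j *: f j); last first.
  by apply/funext => t; rewrite fct_sumE; apply: eq_bigr.
elim/big_ind : _ => [|g h gP hP|j _].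
- exact: (proj1 (Lfun_addr_closed nu (le1_2e R))).
- exact: Lfun2_add.
- rewrite -[_ *: _]addr0.
  apply: (proj2 (Lfun_submod_closed nu (le1_2e R))) => //.
  exact: (proj1 (Lfun_addr_closed nu (le1_2e R))).
Qed.

Lemma L2norm_scale_delta (a : R) j :
  L2norm nu (lincomb f (a *: delta_mx 0 j)) = `|a| * L2norm nu (f j).
Proof.
have fin : 'N[nu]_2%:E[EFin \o f j]%E \is a fin_num.
  rewrite ge0_fin_numE ?Lnorm_ge0//.
  by have := fL2 j; rewrite inE => /andP[_]; rewrite inE.
rewrite lincomb_scale_delta /L2norm.
rewrite (_ : _ \o _ = EFin \o (a \*: f j)); last first.
  by apply/funext => x.
by rewrite (LnormZ (Lfun_Sub (le1_2e R) (fL2 j))) fineM.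
Qed.

(** The cross term is 2 <f_y - f_0, f_v>, hence linear in the coefficients of
    v; this is all that the sampling argument uses of the inner product. *)
Lemma L2norm_expand (f0 : T -> R) : f0 \in Lfun nu 2%:E ->
  forall y : 'rV[R]_M, exists g : 'I_M -> R, forall v,
  L2norm nu (lincomb f (y + v) \- f0) ^+ 2 =
  L2norm nu (lincomb f y \- f0) ^+ 2 + \sum_j v ord0 j * g j +
  L2norm nu (lincomb f v) ^+ 2.
Proof.
move=> f0L2 y; pose F := lincomb f y \- f0.
have FL2 : F \in Lfun nu 2%:E by exact: Lfun2_sub (lincomb_L2 _) f0L2.
exists (fun j => 2 * (\int[nu]_x (F x * f j x))%R) => v.
have fFi j : nu.-integrable setT (EFin \o (F \* f j)).
  exact: integrable_mul.
have [cI cE] := Rintegral_lincomb (index_enum 'I_M) (fun j => v ord0 j * 2) fFi.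
have vL2 := lincomb_L2 v.
rewrite !L2norm_sqr.
rewrite (_ : \sum_j _ = (\int[nu]_x (\sum_j (v ord0 j * 2) * (F \* f j) x))%R);
  last by rewrite cE; apply: eq_bigr => j _; rewrite mulrA.
have I1 : nu.-integrable setT (EFin \o (fun x => F x ^+ 2)).
  exact: Lfun2_integrable_sqr.
have I2 : nu.-integrable setT (EFin \o (fun x => (lincomb f v) x ^+ 2)).
  exact: Lfun2_integrable_sqr.
rewrite -RintegralD// -RintegralD//; last first.
  exact: (integrableD measurableT I1 cI).
apply: eq_Rintegral => x _; rewrite lincombD /=.
rewrite (_ : \sum_i _ = 2 * F x * lincomb f v x).
  by rewrite /F /=; ring.
by rewrite /lincomb mulr_sumr; apply: eq_bigr => j _; ring.
Qed.

End L2.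

(** * Maurey's sampling argument *)

Section Maurey.
Context (R : realType) (M : nat).
Implicit Types (x y v : 'rV[R]_M) (q Q : 'rV[R]_M -> R).

(** Second order Taylor expansion with a remainder Q that does not depend on
    the base point y; the gradient g does. *)
Definition quadratic_expansion q Q := forall y, exists g : 'I_M -> R,
  forall v, q (y + v) = q y + \sum_j v ord0 j * g j + Q v.

Definition steps_towards x (h : R) (m : 'I_M -> nat) : 'rV[R]_M :=
  \row_j (h * Num.sg (x ord0 j) * (m j)%:R).

Variables q Q : 'rV[R]_M -> R.
Hypothesis qQ : quadratic_expansion q Q.
Hypothesis Q_ge0 : forall v, 0 <= Q v.
Hypothesis Q_axis : forall a j, Q (a *: delta_mx 0 j) <= a ^+ 2.

(** Draw v = L sgn(x_j) e_j with probability |x_j|/L, and v = 0 with the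
    remaining probability.  The mean of v is x, so the mean of q (y + v) is at
    most q y + <g, x> + L^2 <= q (y + x) + L^2, and some value of v does not
    exceed the mean. *)
Lemma maurey_step (L : R) x y : \sum_j `|x ord0 j| <= L ->
  q y <= q (y + x) + L ^+ 2 \/
  exists2 j, x ord0 j != 0 &
    q (y + (L * Num.sg (x ord0 j)) *: delta_mx 0 j) <= q (y + x) + L ^+ 2.
Proof.
move=> xL; have [g gE] := qQ y.
have L0 : 0 <= L by apply: le_trans xL; exact: sumr_ge0.
set G := \sum_j x ord0 j * g j.
have qyx : q (y + x) = q y + G + Q x by exact: gE.
have Qx := Q_ge0 x.
have [_|qy] := leP (q y) (q (y + x) + L ^+ 2); [by left|right].
have G0 : G < 0 by move: qy; have := sqr_ge0 L; lra.
apply: contrapT => noj.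
have gj j : x ord0 j != 0 -> G < L * Num.sg (x ord0 j) * g j.
  move=> xj0; rewrite ltNge; apply/negP => Gj; apply: noj; exists j => //.
  have -> : q (y + (L * Num.sg (x ord0 j)) *: delta_mx 0 j) =
    q y + L * Num.sg (x ord0 j) * g j +
    Q ((L * Num.sg (x ord0 j)) *: delta_mx 0 j).
    rewrite gE; congr (_ + _ + _); rewrite (bigD1 j)//= big1 ?addr0.
      by rewrite !mxE !eqxx mulr1.
    by move=> i ij; rewrite !mxE (negbTE ij) andbF mulr0 mul0r.
  have := Q_axis (L * Num.sg (x ord0 j)) j.
  rewrite exprMn sqr_sg xj0 mulr1; lra.
have termE j : `|x ord0 j| * (L * Num.sg (x ord0 j) * g j - G) =
    L * (x ord0 j * g j) - `|x ord0 j| * G.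
  by rewrite {3}[x ord0 j]numEsg; ring.
(* If no draw were good, the nonnegative terms below would have a sum <= 0. *)
have term_ge0 j : true -> 0 <= `|x ord0 j| * (L * Num.sg (x ord0 j) * g j - G).
  move=> _; have [->|xj0] := eqVneq (x ord0 j) 0; first by rewrite normr0 mul0r.
  by rewrite mulr_ge0// subr_ge0 ltW// gj.
have sum0 : \sum_j `|x ord0 j| * (L * Num.sg (x ord0 j) * g j - G) = 0.
  apply/eqP; rewrite eq_le sumr_ge0// andbT.
  under eq_bigr do rewrite termE.
  rewrite sumrB -mulr_sumr -/G -mulr_suml -mulrBl.
  by rewrite mulr_ge0_le0 ?subr_ge0// ltW.
suff Gz : G = 0 by move: G0; rewrite Gz ltxx.
apply: big1 => j _.
have [->|xj0] := eqVneq (x ord0 j) 0; first by rewrite mul0r.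
have /(_ j isT) := psumr_eq0P term_ge0 sum0; move=> /eqP.
by rewrite mulf_eq0 normr_eq0 (negbTE xj0) /= subr_eq0 gt_eqF ?gj.
Qed.

(** Greedy choice: each step replaces one copy of x by one draw, and loses at
    most h^2. *)
Lemma maurey_iter (h : R) x k y : \sum_j `|x ord0 j| <= h ->
  exists m : 'I_M -> nat,
  [/\ forall j, x ord0 j = 0 -> m j = 0%N, (\sum_j m j <= k)%N &
      q (y + steps_towards x h m) <= q (y + k%:R *: x) + k%:R * h ^+ 2].
Proof.
move=> xh; elim: k y => [|k IH] y.
  exists (fun _ => 0%N); split => //; first by rewrite big1.
  rewrite (_ : steps_towards _ _ _ = 0) ?scale0r ?mul0r ?addr0//.
  by apply/rowP => j; rewrite !mxE mulr0.
have [m [m0 mk qm]] := IH (y + x).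
have -> : q (y + k.+1%:R *: x) = q (y + x + k%:R *: x).
  by rewrite -[k.+1]add1n natrD scalerDl scale1r addrA.
have kE : k.+1%:R * h ^+ 2 = k%:R * h ^+ 2 + h ^+ 2.
  by rewrite -[k.+1]addn1 natrD; ring.
have [] := maurey_step (y + steps_towards x h m) xh.
  move=> qs; exists m; split => //; first exact: leqW.
  by rewrite kE addrA (le_trans qs)// lerD2r addrAC.
case=> j xj0 qs; exists (fun i => m i + (i == j))%N; split.
- move=> i xi0; rewrite m0//; case: eqP => // ij.
  by rewrite -ij xi0 eqxx in xj0.
- have -> : (\sum_i (m i + (i == j)) = (\sum_i m i).+1)%N.
    rewrite big_split /= -addn1; congr addn.
    by rewrite (bigD1 j)//= eqxx big1 ?addn0// => i /negbTE ->.
  by rewrite ltnS.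
- rewrite kE addrA.
  apply: le_trans (_ : q (y + steps_towards x h m + x) + h ^+ 2 <= _).
    rewrite (_ : y + _ =
      y + steps_towards x h m + (h * Num.sg (x ord0 j)) *: delta_mx 0 j)//.
    rewrite -addrA; congr (_ + _); apply/rowP => i.
    rewrite !mxE natrD mulrDr eqxx /=; congr (_ + _).
    by case: eqP => [->//|_]; rewrite !mulr0.
  by rewrite lerD2r addrAC.
Qed.

(** Sampling x/n instead of x makes each of the n steps cost (L/n)^2. *)
Lemma maurey (L : R) x y n : (0 < n)%N -> \sum_j `|x ord0 j| <= L ->
  exists m : 'I_M -> nat,
  [/\ forall j, x ord0 j = 0 -> m j = 0%N, (\sum_j m j <= n)%N &
      q (y + steps_towards x (L / n%:R) m) <= q (y + x) + L ^+ 2 / n%:R].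
Proof.
move=> n0 xL; have nR : 0 < n%:R :> R by rewrite ltr0n.
have nN0 : n%:R != 0 :> R by rewrite gt_eqF.
have xn : \sum_j `|(n%:R^-1 *: x) ord0 j| <= L / n%:R.
  under eq_bigr do rewrite mxE normrM gtr0_norm ?invr_gt0//.
  by rewrite -mulr_sumr mulrC ler_wpM2r// invr_ge0 ltW.
have [m [m0 mn qm]] := maurey_iter n y xn; exists m; split => //.
  by move=> j xj0; apply: m0; rewrite mxE xj0 mulr0.
move: qm; rewrite scalerA mulfV// scale1r.
rewrite (_ : n%:R * _ = L ^+ 2 / n%:R); last by field.
congr (q (y + _) <= _); apply/rowP => j; rewrite !mxE.
by rewrite sgrM gtr0_sg ?invr_gt0// mul1r.
Qed.

End Maurey.

(** * Thresholding and sparse approximation *)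

Section Threshold.
Context (R : realType) (M : nat).
Implicit Types (x y : 'rV[R]_M) (q tau : R).

Definition lqsum q x := \sum_j `|x ord0 j| `^ q.

Lemma lqsum_ge0 q x : 0 <= lqsum q x.
Proof. by apply: sumr_ge0 => j _; exact: powR_ge0. Qed.

Lemma lqnorm_le q t x : 0 < q -> 0 <= t ->
  (lqnorm q x <= t) = (lqsum q x <= t `^ q).
Proof.
move=> q0 t0; have s0 := lqsum_ge0 q x.
have qN0 : q != 0 by rewrite gt_eqF.
rewrite /lqnorm -/(lqsum q x).
have e : t = (t `^ q) `^ q^-1 by rewrite -powRrM mulfV// powRr1.
apply/idP/idP => [h|h].
  have -> : lqsum q x = (lqsum q x `^ q^-1) `^ q.
    by rewrite -powRrM mulVf// powRr1.
  by rewrite ge0_ler_powR ?nnegrE ?powR_ge0 ?(ltW q0).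
by rewrite [leRHS]e ge0_ler_powR ?nnegrE ?powR_ge0 ?invr_ge0 ?(ltW q0).
Qed.

Lemma powR_1BqMq q (a : R) : 0 <= a -> a `^ (1 - q) * a `^ q = a.
Proof. by move=> a0; rewrite -powRD ?subrK ?oner_eq0// powRr1. Qed.

(** a = a^(1-q) a^q, and both factors increase with a. *)
Lemma le_powR_threshold q tau (a b : R) : 0 < q -> q <= 1 -> 0 <= a ->
  a <= tau -> a <= b -> a <= tau `^ (1 - q) * b `^ q.
Proof.
move=> q0 q1 a0 atau ab.
have [->|aN0] := eqVneq a 0; first by rewrite mulr_ge0 ?powR_ge0.
have tau0 : 0 <= tau := le_trans a0 atau.
have b0 : 0 <= b := le_trans a0 ab.
rewrite -[leLHS](powR_1BqMq q)//.
by rewrite ler_pM ?powR_ge0 ?ge0_ler_powR ?nnegrE ?subr_ge0 ?(ltW q0).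
Qed.

(** A nonnegative integer m satisfies m^q <= m for q <= 1: m steps of size h
    on the same coordinate weigh no more than m separate coordinates equal to
    h.  The second inequality makes the l_q mass control the number of nonzero
    coordinates too. *)
Lemma rounded_coeff q tau (h a : R) (m : nat) : 0 < q -> q <= 1 -> 0 < tau ->
  tau <= h ->
  `|h * Num.sg a * m%:R| `^ q <= m%:R * h `^ q /\
  (h * Num.sg a * m%:R != 0)%:R * tau `^ q <= m%:R * h `^ q.
Proof.
move=> q0 q1 tau0 tauh; have h0 : 0 < h := lt_le_trans tau0 tauh.
case: m => [|m].
  by rewrite mulr0 normr0 powR0 ?(gt_eqF q0)// eqxx !mul0r.
split.
  rewrite !normrM (gtr0_norm h0) normr_nat -mulrA powRM ?(ltW h0) ?mulr_ge0//.
  rewrite mulrC ler_wpM2r ?powR_ge0//.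
  apply: le_trans (_ : m.+1%:R `^ q <= _); last by rewrite ler1_powR// ler1n.
  rewrite ge0_ler_powR ?nnegrE ?mulr_ge0 ?(ltW q0)//.
  by rewrite ler_piMl// normr_sg; case: (_ != 0).
apply: ler_pM => //; first exact: powR_ge0.
  by apply: le_trans (_ : 1 <= _); [case: (_ != 0)|rewrite ler1n].
by rewrite ge0_ler_powR ?nnegrE ?(ltW q0) ?(ltW tau0) ?(ltW h0).
Qed.

(** The typical x is the part of y that lies below the threshold, or the
    remainder of y after rounding. *)
Lemma sum_le_threshold q tau x y : 0 < q -> q <= 1 ->
  (forall j, `|x ord0 j| <= tau) -> (forall j, `|x ord0 j| <= `|y ord0 j|) ->
  \sum_j `|x ord0 j| <= tau `^ (1 - q) * lqsum q y.
Proof.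
move=> q0 q1 xtau xy; rewrite /lqsum mulr_sumr; apply: ler_sum => j _.
exact: le_powR_threshold.
Qed.

(** The threshold t is never exceeded on the l_q ball of radius t. *)
Lemma lqsum_le_l1 q t x : 0 < q -> q <= 1 -> 0 < t -> lqsum q x <= t `^ q ->
  \sum_j `|x ord0 j| <= t.
Proof.
move=> q0 q1 t0 xt.
have xjt j : `|x ord0 j| <= t.
  have : `|x ord0 j| `^ q <= t `^ q.
    apply: le_trans xt; rewrite /lqsum (bigD1 j)//= lerDl.
    by apply: sumr_ge0 => i _; exact: powR_ge0.
  apply: contraTT; rewrite -!ltNge => tx.
  by rewrite gt0_ltr_powR ?nnegrE// ltW.
apply: le_trans (sum_le_threshold q0 q1 xjt (fun j => lexx _)) _.
apply: le_trans (ler_wpM2l _ xt) _; first exact: powR_ge0.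
by rewrite powR_1BqMq ?(ltW t0).
Qed.

Definition big_part tau x : 'rV[R]_M :=
  \row_j (if tau < `|x ord0 j| then x ord0 j else 0).
Definition small_part tau x : 'rV[R]_M :=
  \row_j (if tau < `|x ord0 j| then 0 else x ord0 j).

Lemma big_small_part tau x : big_part tau x + small_part tau x = x.
Proof.
by apply/rowP => j; rewrite !mxE; case: ifP; rewrite ?addr0 ?add0r.
Qed.

Lemma lqsum_parts q tau x : 0 < q ->
  lqsum q x = lqsum q (big_part tau x) + lqsum q (small_part tau x).
Proof.
move=> q0; rewrite /lqsum -big_split; apply: eq_bigr => j _; rewrite !mxE /=.
by case: ifP => _; rewrite normr0 powR0 ?(gt_eqF q0)// ?addr0 ?add0r.
Qed.

Lemma small_part_le tau x j : 0 <= tau -> `|small_part tau x ord0 j| <= tau.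
Proof. by move=> tau0; rewrite mxE; case: ltP; rewrite ?normr0. Qed.

Lemma small_part_l1 q tau x : 0 < q -> q <= 1 -> 0 < tau ->
  \sum_j `|small_part tau x ord0 j| <=
    tau `^ (1 - q) * lqsum q (small_part tau x).
Proof.
move=> q0 q1 tau0; apply: sum_le_threshold => // j.
by rewrite small_part_le// ltW.
Qed.

End Threshold.

(** The properties of theta |-> ||f_theta|| that the finite dimensional part
    of the argument needs. *)
Record hilbertian_seminorm (R : realType) (M : nat)
    (N : 'rV[R]_M -> R) : Prop :=
  HilbertianSeminorm {
    hs_ge0 : forall x, 0 <= N x;
    hs_triangle : forall x y, N (x + y) <= N x + N y;
    hs_opp : forall x, N (- x) = N x;
    hs_axis : forall a j, N (a *: delta_mx 0 j) <= `|a|;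
    hs_expand : quadratic_expansion (fun x => N x ^+ 2) (fun x => N x ^+ 2) }.

Section Sparse.
Context (R : realType) (M : nat) (N : 'rV[R]_M -> R).
Hypothesis hN : hilbertian_seminorm N.
Implicit Types (x y : 'rV[R]_M) (q tau : R).

Lemma hs_axis_sqr (a : R) j : N (a *: delta_mx 0 j) ^+ 2 <= a ^+ 2.
Proof.
rewrite -[leRHS]real_normK ?num_real//.
by rewrite lerXn2r ?nnegrE ?(hs_ge0 hN) ?(hs_axis hN).
Qed.

Lemma hs0 : N 0 = 0.
Proof.
apply/eqP; rewrite eq_le (hs_ge0 hN) andbT.
have [g gE] := hs_expand hN 0; have := gE 0.
rewrite addr0 big1 ?addr0 => [|j _]; last by rewrite mxE mul0r.
by move=> e; have /eqP : N 0 ^+ 2 = 0 by [lra]; rewrite sqrf_eq0 => /eqP ->.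
Qed.

Lemma hs_le_l1 x : N x <= \sum_j `|x ord0 j|.
Proof.
rewrite {1}(row_sum_delta x).
elim/big_ind2 : _ => [|a u b v au bv|j _]; first by rewrite hs0.
  exact: le_trans (hs_triangle hN _ _) (lerD _ _).
exact: hs_axis.
Qed.

Lemma maurey_dist (L : R) z x y n : (0 < n)%N -> \sum_j `|x ord0 j| <= L ->
  exists m : 'I_M -> nat,
  [/\ forall j, x ord0 j = 0 -> m j = 0%N, (\sum_j m j <= n)%N &
      N (y + steps_towards x (L / n%:R) m - z) ^+ 2 <=
      N (y + x - z) ^+ 2 + L ^+ 2 / n%:R].
Proof.
move=> n0 xL; pose q v := N (v - z) ^+ 2.
have qQ : quadratic_expansion q (fun v => N v ^+ 2).
  move=> u; have [g gE] := hs_expand hN (u - z); exists g => v.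
  by rewrite /q -gE addrAC.
exact: (maurey qQ (fun v => sqr_ge0 (N v)) hs_axis_sqr y n0 xL).
Qed.

(** The coefficients larger than tau are kept.  The others, of total mass L,
    are sampled n = floor (L/tau) times (dropped if n = 0), so that the step
    h = L/n lies between tau and 2 tau.  As h >= tau, the n steps weigh
    n h^q = L h^(q-1), which is at most L tau^(q-1) and hence at most the l_q
    mass of the coefficients that they replace; as h <= 2 tau, the error
    L^2/n = L h is at most 2 tau^(2-q) lqsum q x. *)
Lemma sparse_approx q tau x : 0 < q -> q <= 1 -> 0 < tau ->
  exists x', [/\ lqsum q x' <= lqsum q x,
    (l0norm x')%:R * tau `^ q <= lqsum q x &
    N (x' - x) ^+ 2 <= 2 * tau `^ (2 - q) * lqsum q x].
Proof.
move=> q0 q1 tau0.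
set y := big_part tau x; set u := small_part tau x.
have xE : y + u = x := big_small_part tau x.
have WE := lqsum_parts tau x q0; rewrite -/y -/u in WE.
have uW : lqsum q u <= lqsum q x by rewrite WE lerDr lqsum_ge0.
set L := \sum_j `|u ord0 j|.
have LW : L <= tau `^ (1 - q) * lqsum q u by exact: small_part_l1.
have L0 : 0 <= L by exact: sumr_ge0.
have tauL : tau * L <= tau `^ (2 - q) * lqsum q x.
  have -> : tau `^ (2 - q) = tau * tau `^ (1 - q).
    rewrite -{2}[tau]powRr1 ?(ltW tau0)// -powRD.
      by congr (_ `^ _); ring.
    by rewrite (gt_eqF tau0) implybT.
  rewrite -mulrA ler_wpM2l ?(ltW tau0)//.
  by apply: le_trans LW _; rewrite ler_wpM2l// powR_ge0.
have tW0 : 0 <= tau `^ (2 - q) * lqsum q x.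
  by rewrite mulr_ge0 ?powR_ge0 ?lqsum_ge0.
have tq0 : 0 < tau `^ q by rewrite powR_gt0.
(* It remains to choose the step h and the multiplicities m. *)
suff [h [m [tauh m0 mh dist]]] : exists h (m : 'I_M -> nat),
  [/\ tau <= h, forall j, u ord0 j = 0 -> m j = 0%N,
     \sum_j (m j)%:R * h `^ q <= lqsum q u &
     N (y + steps_towards u h m - x) ^+ 2 <= 2 * tau `^ (2 - q) * lqsum q x].
  have h0 : 0 < h := lt_le_trans tau0 tauh.
  have hq0 : 0 <= h `^ q by rewrite powR_ge0.
  pose x' := y + steps_towards u h m; exists x'.
  (* The same bound serves for the l_q mass and for the number of nonzeros. *)
  have pw j : `|x' ord0 j| `^ q <= `|y ord0 j| `^ q + (m j)%:R * h `^ q /\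
      (x' ord0 j != 0)%:R * tau `^ q <= `|y ord0 j| `^ q + (m j)%:R * h `^ q.
    rewrite /x' mxE [steps_towards _ _ _ _ _]mxE; move: (m0 j).
    rewrite [y ord0 j]mxE [u ord0 j]mxE; case: ifPn => [big|nbig].
      move=> -> //; rewrite mulr0 mul0r !addr0; split => //.
      have xj0 : x ord0 j != 0.
        by apply: contraTneq big => ->; rewrite normr0 -leNgt ltW.
      rewrite xj0 mul1r ge0_ler_powR ?nnegrE ?(ltW q0) ?(ltW tau0)//.
      exact: ltW.
    move=> _; rewrite normr0 powR0 ?(gt_eqF q0)// !add0r.
    exact: rounded_coeff.
  have sumW : \sum_j (`|y ord0 j| `^ q + (m j)%:R * h `^ q) <= lqsum q x.
    by rewrite big_split /= WE lerD2l.
  split => //.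
    by apply: le_trans sumW; apply: ler_sum => j _; have [] := pw j.
  apply: le_trans sumW; rewrite /l0norm natr_sum mulr_suml.
  by apply: ler_sum => j _; have [] := pw j.
set n := Num.truncn (L / tau).
have := truncn_itv (divr_ge0 L0 (ltW tau0)); rewrite -/n => /andP[nL Ln].
have [n0|n0] := posnP n.
  exists tau, (fun=> 0%N); split => //.
    by rewrite big1 ?lqsum_ge0// => j _; rewrite mul0r.
  have -> : steps_towards u tau (fun=> 0%N) = 0.
    by apply/rowP => j; rewrite !mxE mulr0.
  rewrite addr0 -{1}xE opprD addNKr (hs_opp hN).
  have Ltau : L <= tau by move: Ln; rewrite n0 ltr_pdivrMr// mul1r => /ltW.
  have NL := hs_le_l1 u; rewrite -/L in NL.
  have NL2 : N u ^+ 2 <= L ^+ 2 by rewrite lerXn2r ?nnegrE ?(hs_ge0 hN).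
  have : L ^+ 2 <= tau * L by rewrite expr2 ler_wpM2r.
  lra.
have nR : 0 < n%:R :> R by rewrite ltr0n.
have [m [m0 mn dist]] := maurey_dist x y n0 (lexx L).
have tauh : tau <= L / n%:R.
  by rewrite ler_pdivlMr// mulrC -ler_pdivlMr.
have hL : L / n%:R <= 2 * tau.
  rewrite ler_pdivrMr//.
  move: Ln; rewrite ltr_pdivrMr// => /ltW /le_trans -> //.
  rewrite -addn1 natrD.
  have : (1 : R) <= n%:R by rewrite ler1n.
  nra.
exists (L / n%:R), m; split => //.
  have h0 : 0 < L / n%:R := lt_le_trans tau0 tauh.
  rewrite -mulr_suml -natr_sum.
  apply: le_trans (_ : n%:R * (L / n%:R) `^ q <= _).
    by rewrite ler_wpM2r ?powR_ge0// ler_nat.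
  have t1q : 0 < tau `^ (1 - q) by rewrite powR_gt0.
  rewrite -(ler_pM2l t1q); apply: le_trans LW.
  rewrite [leRHS](_ : _ = n%:R * ((L / n%:R) `^ (1 - q) * (L / n%:R) `^ q));
    last first.
    by rewrite powR_1BqMq ?(ltW h0)// mulrC divfK ?(gt_eqF nR).
  rewrite mulrCA ler_wpM2l ?(ltW nR)// ler_wpM2r ?powR_ge0//.
  by rewrite ge0_ler_powR ?nnegrE ?subr_ge0 ?(ltW tau0) ?(ltW h0).
apply: le_trans dist _; rewrite xE subrr hs0 expr0n /= add0r.
have -> : L ^+ 2 / n%:R = L * (L / n%:R) by ring.
have : L * (L / n%:R) <= L * (2 * tau) by rewrite ler_wpM2l.
lra.
Qed.

End Sparse.

(** * Counting integer vectors in l_q balls *)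

Section Counting.
Context (R : realType).
Implicit Types q : R.

Lemma sum_inv_sqr (B : nat) : \sum_(i < B) ((i.+1%:R : R) ^+ 2)^-1 <= 2.
Proof.
case: B => [|B]; first by rewrite big_ord0.
suff : \sum_(i < B.+1) ((i.+1%:R : R) ^+ 2)^-1 <= 2 - B.+1%:R^-1.
  by move=> /le_trans -> //; rewrite gerBl invr_ge0.
elim: B => [|B IH]; first by rewrite big_ord1 expr1n invr1; lra.
rewrite big_ord_recr /=; apply: le_trans (lerD IH (lexx _)) _.
have b0 : 0 < B.+1%:R :> R by rewrite ltr0n.
rewrite -[B.+2]addn1 natrD; move: b0; move: (B.+1%:R : R) => b b0.
have -> : (b + 1%:R)^-1 = b^-1 - (b * (b + 1))^-1.
  by field; rewrite !gt_eqF// addr_gt0.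
have : ((b + 1%:R) ^+ 2)^-1 <= (b * (b + 1))^-1.
  rewrite lef_pV2 ?posrE ?mulr_gt0 ?exprn_gt0 ?addr_gt0//.
  by rewrite expr2 ler_pM2r ?addr_gt0// lerDl.
lra.
Qed.

(** From e^x >= x one gets exp (z^q) >= (q/2)^(2/q) z^2, and the
    series of the inverse squares is bounded. *)
Lemma sum_expR_powR q : 0 < q -> exists2 C : R, 0 < C &
  forall B : nat, \sum_(i < B) expR (1 - i.+1%:R `^ q) <= C.
Proof.
move=> q0; pose D := expR 1 / (q / 2) `^ (2 / q) : R.
have q20 : 0 < q / 2 by rewrite divr_gt0.
have p0 : 0 < (q / 2) `^ (2 / q) by rewrite powR_gt0.
have D0 : 0 < D by rewrite divr_gt0// expR_gt0.
exists (D * 2); first by rewrite mulr_gt0.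
move=> B; apply: le_trans (_ : D * \sum_(i < B) ((i.+1%:R : R) ^+ 2)^-1 <= _).
  rewrite mulr_sumr; apply: ler_sum => i _.
  have z0 : 0 < i.+1%:R :> R by rewrite ltr0n.
  rewrite expRD expRN /D -mulrA ler_wpM2l ?expR_ge0// -invfM.
  rewrite lef_pV2 ?posrE ?expR_gt0 ?mulr_gt0 ?exprn_gt0//.
  have -> : expR (i.+1%:R `^ q) = expR (i.+1%:R `^ q * (q / 2)) `^ (2 / q).
    by rewrite -expRM; congr expR; field; rewrite gt_eqF.
  have -> : i.+1%:R ^+ 2 = (i.+1%:R `^ q) `^ (2 / q) :> R.
    rewrite -powRrM -[LHS]powR_mulrn ?(ltW z0)//; congr (_ `^ _).
    by field; rewrite gt_eqF.
  rewrite mulrC -powRM ?powR_ge0 ?(ltW q20)//.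
  rewrite ge0_ler_powR ?nnegrE ?expR_ge0 ?divr_ge0 ?mulr_ge0 ?powR_ge0//;
    rewrite ?(ltW q0) ?(ltW q20)//.
  by apply: le_trans (expR_ge1Dx _); rewrite lerDr.
by rewrite ler_wpM2l ?(ltW D0)// sum_inv_sqr.
Qed.

(** The integer points of the l_q ball sum_j z_j^q <= K of the positive
    orthant are enumerated by a finite type I of controlled cardinality.  The
    bound is uniform in the dimension M and in K. *)
Definition lattice_count_bound q (C : R) := forall (M : nat) (K : R), 0 < K ->
  exists (I : finType) (a : I -> 'I_M -> nat),
    (#|I|%:R : R) <= expR (K * (1 + C + ln (1 + M%:R / K))) /\
    forall z : 'I_M -> nat, \sum_j (z j)%:R `^ q <= K ->
      exists i, forall j, a i j = z j.

(** Chernoff's bound.  Every z in the ball has weight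
    exp (l (K - sum_j z_j^q)) >= 1, and the total weight factorises over the
    coordinates as exp (l K) (sum_z exp (- l z^q))^M.  With
    l = 1 + ln (1 + M/K) the inner sum is at most 1 + C exp (- l), and
    M exp (- l) <= K. *)
Lemma count_nat_vectors q : 0 < q ->
  exists2 C : R, 0 < C & lattice_count_bound q C.
Proof.
move=> q0; have [C C0 CP] := sum_expR_powR q0; exists C => // M K K0.
pose B := Num.truncn (K `^ q^-1).
pose P := [pred z : {ffun 'I_M -> 'I_B.+1} |
  \sum_j (nat_of_ord (z j))%:R `^ q <= K].
exists {z | P z}, (fun (i : {z | P z}) j => nat_of_ord (proj1_sig i j)).
split; last first.
  move=> z zK.
  have zB j : (z j < B.+1)%N.
    rewrite ltnS /B truncn_ge_nat ?powR_ge0//.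
    have zj : (z j)%:R `^ q <= K.
      apply: le_trans zK; rewrite (bigD1 j)//= lerDl.
      by apply: sumr_ge0 => i _; exact: powR_ge0.
    have -> : (z j)%:R = ((z j)%:R `^ q) `^ q^-1 :> R.
      by rewrite -powRrM mulfV ?gt_eqF// powRr1.
    by rewrite ge0_ler_powR ?nnegrE ?powR_ge0 ?invr_ge0 ?(ltW q0) ?(ltW K0).
  pose zf := [ffun j => Ordinal (zB j)].
  have Pz : P zf by rewrite inE /=; under eq_bigr do rewrite ffunE.
  by exists (exist _ zf Pz) => j /=; rewrite ffunE.
have MK0 : 0 <= M%:R / K by rewrite divr_ge0// ltW.
have K1 : 0 < 1 + M%:R / K by rewrite ltr_pwDl.
set l := 1 + ln (1 + M%:R / K).
have l1 : 1 <= l by rewrite lerDl ln_ge0// lerDl.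
rewrite card_sig -sum1_card natr_sum.
apply: le_trans (_ : \sum_(z : {ffun 'I_M -> 'I_B.+1})
  expR (l * K) * \prod_j expR (- l * (nat_of_ord (z j))%:R `^ q) <= _).
  rewrite big_mkcond; apply: ler_sum => z _; case: ifP => [|_]; last first.
    by rewrite mulr_ge0 ?expR_ge0//; apply: prodr_ge0 => j _; exact: expR_ge0.
  rewrite inE => zK; rewrite -expR_sum -expRD -mulr_sumr mulNr -mulrBr.
  apply: le_trans (expR_ge1Dx _); rewrite lerDl mulr_ge0 ?subr_ge0//.
  exact: le_trans l1.
rewrite -mulr_sumr.
rewrite -(bigA_distr_bigA
  (fun _ (v : 'I_B.+1) => expR (- l * (nat_of_ord v)%:R `^ q))) /=.
rewrite prodr_const card_ord big_ord_recl powR0 ?gt_eqF// mulr0 expR0.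
have tail : \sum_(i < B) expR (- l * (lift ord0 i)%:R `^ q) <= C * expR (- l).
  apply: le_trans
    (_ : (\sum_(i < B) expR (1 - i.+1%:R `^ q)) * expR (- l) <= _).
    rewrite mulr_suml; apply: ler_sum => i _; rewrite -expRD ler_expR.
    rewrite [_ (lift _ _)]/=.
    have : 1 <= i.+1%:R `^ q :> R.
      apply: le_trans (_ : 1 `^ q <= _); first by rewrite powR1.
      by rewrite ge0_ler_powR ?nnegrE ?(ltW q0)// ler1n.
    set p := (X in 1 <= X); rewrite /bump add1n -/p; nra.
  by rewrite ler_wpM2r ?expR_ge0.
have el : M%:R * expR (- l) <= K.
  rewrite /l opprD expRD expRN expRN lnK ?posrE//.
  have e1 : (expR 1)^-1 <= 1 :> R.
    by rewrite invf_le1 ?expR_gt0// ltW// expR_gt1.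
  apply: le_trans (_ : M%:R * (1 + M%:R / K)^-1 <= _).
    rewrite ler_wpM2l// ler_piMl// invr_ge0 ltW//.
  rewrite ler_pdivrMr// mulrDr mulr1 mulrCA divff ?gt_eqF// mulr1.
  by rewrite lerDr ltW.
apply: le_trans (_ : expR (l * K) * expR (C * expR (- l)) ^+ M <= _).
  rewrite ler_wpM2l ?expR_ge0// lerXn2r ?nnegrE ?expR_ge0//.
    by rewrite addr_ge0//; apply: sumr_ge0 => i _; exact: expR_ge0.
  apply: le_trans (expR_ge1Dx _); by rewrite lerD2l.
rewrite -expRM_natl -expRD ler_expR /l.
have : C * (M%:R * expR (- l)) <= C * K by rewrite ler_wpM2l// ltW.
rewrite /l; nra.
Qed.

End Counting.

(** * Covers by grid rounding and sampling *)

Section Cover.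
Context (R : realType) (M : nat) (N : 'rV[R]_M -> R).
Hypothesis hN : hilbertian_seminorm N.
Implicit Types (x y : 'rV[R]_M) (q tau : R).

(** A cover by cells of radius delta whose centres need not lie in S. *)
Definition covered (S : 'rV[R]_M -> Prop) (delta E : R) :=
  exists (I : finType) (c : I -> 'rV[R]_M),
    (#|I|%:R : R) <= expR E /\ forall x, S x -> exists i, N (c i - x) <= delta.

(** x = tau a + (tau/X) b + u with integer vectors a and b < X, by rounding
    down to the mesh tau and then to the finer mesh tau/X; u is sampled n
    times.  The centres are parametrised by a, b and the sampled integer vector,
    and the three terms of the exponent count these.  Nonnegative vectors
    spare the choice of signs, which would cost a factor 2^M, too much when M
    is much larger than K. *)
Lemma cover_nonneg q C C1 tau (K L delta : R) (X n : nat) :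
  0 < q -> lattice_count_bound q C -> lattice_count_bound 1 C1 ->
  0 < tau -> 0 < K ->
  (0 < X)%N -> (0 < n)%N ->
  (forall x y, lqsum q y <= K * tau `^ q ->
     (forall j, `|x ord0 j| <= `|y ord0 j|) ->
     (forall j, `|x ord0 j| <= tau / X%:R) -> \sum_j `|x ord0 j| <= L) ->
  0 <= delta -> L ^+ 2 <= n%:R * delta ^+ 2 ->
  covered (fun x => (forall j, 0 <= x ord0 j) /\ lqsum q x <= K * tau `^ q)
    delta
    (K * (1 + C + ln (1 + M%:R / K)) + M%:R * ln X%:R +
     n%:R * (1 + C1 + ln (1 + M%:R / n%:R))).
Proof.
move=> q0 cq c1 tau0 K0 X0 n0 HL d0 Ld.
have nR : 0 < n%:R :> R by rewrite ltr0n.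
have XR : 0 < X%:R :> R by rewrite ltr0n.
have tq0 : 0 < tau `^ q by rewrite powR_gt0.
have tX0 : 0 < tau / X%:R by rewrite divr_gt0.
have [Ia [a [aE aP]]] := cq M K K0.
have [Im [w [wE wP]]] := c1 M n%:R nR.
pose I := (Ia * {ffun 'I_M -> 'I_X} * Im)%type.
pose pt (i : I) : 'rV[R]_M := \row_j ((a i.1.1 j)%:R * tau +
  (nat_of_ord (i.1.2 j))%:R * (tau / X%:R) + L / n%:R * (w i.2 j)%:R).
exists I, pt; split.
  rewrite !card_prod card_ffun !card_ord !natrM natrX !expRD.
  rewrite expRM_natl lnK ?posrE//.
  by rewrite !ler_pM ?mulr_ge0 ?exprn_ge0.
move=> x [x0 xK].
pose aj j := Num.truncn (x ord0 j / tau).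
have ajP j : (aj j)%:R * tau <= x ord0 j < (aj j)%:R * tau + tau.
  have := truncn_itv (divr_ge0 (x0 j) (ltW tau0)).
  by rewrite ler_pdivlMr// ltr_pdivrMr// -natr1 [(_ + 1) * _]mulrDl mul1r.
pose rho j := x ord0 j - (aj j)%:R * tau.
have rho0 j : 0 <= rho j by rewrite subr_ge0; have /andP[] := ajP j.
have rhot j : rho j < tau by rewrite ltrBlDl; have /andP[] := ajP j.
pose bj j := Num.truncn (rho j / (tau / X%:R)).
have bjP j : (bj j)%:R * (tau / X%:R) <= rho j <
    (bj j)%:R * (tau / X%:R) + tau / X%:R.
  have := truncn_itv (divr_ge0 (rho0 j) (ltW tX0)).
  by rewrite ler_pdivlMr// ltr_pdivrMr// -natr1 [(_ + 1) * _]mulrDl mul1r.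
have bX j : (bj j < X)%N.
  rewrite -(ltr_nat R) -(ltr_pM2r tX0); have /andP[/le_lt_trans -> //] := bjP j.
  by rewrite mulrCA divff ?mulr1// gt_eqF.
pose u : 'rV[R]_M := \row_j (rho j - (bj j)%:R * (tau / X%:R)).
pose y : 'rV[R]_M := \row_j ((aj j)%:R * tau + (bj j)%:R * (tau / X%:R)).
have yu : y + u = x.
  by apply/rowP => j; rewrite !mxE /rho; ring.
have u0 j : 0 <= u ord0 j by rewrite mxE subr_ge0; have /andP[] := bjP j.
have aj0 j : 0 <= (aj j)%:R * tau by rewrite mulr_ge0// ltW.
have bj0 j : 0 <= (bj j)%:R * (tau / X%:R) by rewrite mulr_ge0// ltW.
have uL : \sum_j `|u ord0 j| <= L.
  apply: (HL u x xK) => j; rewrite !ger0_norm ?u0 ?x0// mxE.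
    by have := aj0 j; have := bj0 j; rewrite /rho; lra.
  by rewrite lerBlDl ltW//; have /andP[] := bjP j.
have [m [m0 mn dist]] := maurey_dist hN x y n0 uL.
have [ia iaE] : exists i, forall j, a i j = aj j.
  apply: aP; rewrite -(ler_pM2r tq0); apply: le_trans xK.
  rewrite mulr_suml; apply: ler_sum => j _.
  rewrite -powRM ?(ltW tau0)// ge0_ler_powR ?nnegrE ?(ltW q0)//.
  by rewrite ger0_norm//; have /andP[] := ajP j.
have [iw iwE] : exists i, forall j, w i j = m j.
  apply: wP; under eq_bigr do rewrite powRr1//.
  by rewrite -natr_sum ler_nat.
exists (ia, [ffun j => Ordinal (bX j)], iw).
rewrite -(@ler_pXn2r _ 2) ?nnegrE ?(hs_ge0 hN)//.
have -> : pt (ia, [ffun j => Ordinal (bX j)], iw) =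
    y + steps_towards u (L / n%:R) m.
  apply/rowP => j; rewrite !mxE /= iaE iwE ffunE /=; congr (_ + _).
  have [uj0|uj0] := eqVneq (u ord0 j) 0; first by rewrite m0// !mulr0.
  move: uj0 (u0 j); rewrite mxE => uj0 uj; rewrite gtr0_sg ?mulr1//.
  by rewrite lt_def uj0.
apply: le_trans dist _; rewrite yu subrr (hs0 hN) expr0n add0r.
by rewrite ler_pdivrMr// mulrC.
Qed.

(** Cover the positive and the negative parts separately. *)
Lemma cover_signed q W delta E : 0 < q ->
  covered (fun x => (forall j, 0 <= x ord0 j) /\ lqsum q x <= W) delta E ->
  covered (fun x => lqsum q x <= W) (2 * delta) (2 * E).
Proof.
move=> q0 [I [c [cE cP]]].
exists (I * I)%type, (fun i => c i.1 - c i.2); split.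
  by rewrite card_prod natrM -[2]/(1 + 1) mulrDl mul1r expRD ler_pM.
move=> x xW.
pose p : 'rV[R]_M := \row_j Num.max (x ord0 j) 0.
pose m : 'rV[R]_M := \row_j Num.max (- x ord0 j) 0.
have pm : p - m = x.
  apply/rowP => j; rewrite !mxE /Num.max oppr_lt0.
  by case: ltgtP => h; rewrite ?subr0 ?sub0r ?opprK// ?h ?oppr0 ?addr0.
have sub (v : 'rV[R]_M) : (forall j, 0 <= v ord0 j <= `|x ord0 j|) ->
    (forall j, 0 <= v ord0 j) /\ lqsum q v <= W.
  move=> vx; split=> [j|]; first by have /andP[] := vx j.
  apply: le_trans xW; apply: ler_sum => j _; have /andP[v0 vj] := vx j.
  by rewrite ge0_ler_powR ?nnegrE ?(ltW q0)// ger0_norm.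
have [|i ip] := cP p.
  by apply: sub => j; rewrite mxE le_max lexx orbT ge_max ler_norm normr_ge0.
have [|k km] := cP m.
  apply: sub => j; rewrite mxE le_max lexx orbT ge_max normr_ge0 andbT /=.
  by rewrite -normrN ler_norm.
exists (i, k) => /=.
have -> : c i - c k - x = (c i - p) + - (c k - m).
  by rewrite -pm !opprB; apply/rowP => j; rewrite !mxE; ring.
apply: le_trans (hs_triangle hN _ _) _; rewrite (hs_opp hN); lra.
Qed.

End Cover.

(** * Metric entropy of l_q balls *)

Section Entropy.
Context (R : realType).
Implicit Types q t eps : R.

Lemma ln2_ge_half : 2^-1 <= ln 2 :> R.
Proof.
have := @le_ln1Dx R (- 2^-1).
rewrite (_ : 1 - 2^-1 = 2^-1 :> R); last by lra.
rewrite lnV ?posrE// lerN2; apply; lra.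
Qed.

Lemma ln1D_ge_half (u : R) : 1 <= u -> 2^-1 <= ln (1 + u).
Proof.
move=> u1; apply: le_trans ln2_ge_half _.
by rewrite ler_ln ?posrE//; lra.
Qed.

Lemma ln_le_2ln1D (u v : R) : 0 < u -> 0 <= v -> u <= (1 + v) ^+ 2 ->
  ln u <= 2 * ln (1 + v).
Proof.
move=> u0 v0 uv; have v1 : 0 < 1 + v by rewrite ltr_pwDl.
have -> : 2 * ln (1 + v) = ln ((1 + v) ^+ 2) by rewrite lnXn// mulr_natl.
by rewrite ler_ln ?posrE// exprn_gt0.
Qed.

Section Scale.
Variables q t eps : R.
Hypotheses (q0 : 0 < q) (q1 : q <= 1) (e0 : 0 < eps) (et : eps < t).
Let t0 : 0 < t := lt_trans e0 et.
Let s := t / eps.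
Let s1 : 1 < s. Proof. by rewrite ltr_pdivlMr// mul1r. Qed.
Let s0 : 0 < s. Proof. exact: lt_trans s1. Qed.

(** K = [sparse_dim] and tau = [sparse_mesh] are tied by K tau^q = t^q and
    K tau^2 = eps^2: by the first, K coefficients of size tau fill the ball; by
    the second, eps is the error of sampling K times a vector of l_1 norm
    K tau. *)
Definition sparse_dim : R := s `^ (2 * q / (2 - q)).
Definition sparse_mesh : R := t * s `^ (- (2 / (2 - q))).

Let q2 : 0 < 2 - q. Proof. by move: q1; lra. Qed.

Lemma sparse_dim_gt0 : 0 < sparse_dim.
Proof. by rewrite powR_gt0. Qed.

Lemma sparse_dim_ge1 : 1 <= sparse_dim.
Proof.
rewrite -(powRr0 s) ler_powR ?(ltW s1)//.
by rewrite divr_ge0 ?mulr_ge0 ?(ltW q0) ?(ltW q2).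
Qed.

Lemma sparse_mesh_gt0 : 0 < sparse_mesh.
Proof. by rewrite mulr_gt0 ?powR_gt0. Qed.

Lemma sparse_dim_meshq : sparse_dim * sparse_mesh `^ q = t `^ q.
Proof.
rewrite /sparse_mesh powRM ?powR_ge0 ?(ltW t0)// -powRrM mulrCA.
rewrite -powRD; last by rewrite (gt_eqF s0) implybT.
rewrite (_ : 2 * q / (2 - q) + _ = 0) ?powRr0 ?mulr1//.
by field; rewrite gt_eqF.
Qed.

Lemma sparse_dim_mesh2 : sparse_dim * sparse_mesh ^+ 2 = eps ^+ 2.
Proof.
rewrite /sparse_mesh exprMn mulrCA -[X in _ * (_ * X)]powR_mulrn ?powR_ge0//.
rewrite -powRrM -powRD; last by rewrite (gt_eqF s0) implybT.
rewrite (_ : 2 * q / (2 - q) + _ = - 2%:R); last by field; rewrite gt_eqF.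
rewrite powR_invn ?(ltW s0)// /s expr_div_n invf_div mulrC divfK//.
by rewrite expf_neq0// gt_eqF.
Qed.

End Scale.

Section Bound.
Context (M : nat) (N : 'rV[R]_M -> R).
Hypothesis hN : hilbertian_seminorm N.
Variables (q t eps C C1 : R).
Hypotheses (M0 : (0 < M)%N) (q0 : 0 < q) (q1 : q <= 1).
Hypotheses (e0 : 0 < eps) (et : eps < t) (C0 : 0 < C) (C10 : 0 < C1).
Hypotheses (cq : lattice_count_bound q C) (c1 : lattice_count_bound 1 C1).
Let t0 : 0 < t := lt_trans e0 et.
Let MR : 0 < M%:R :> R. Proof. by rewrite ltr0n. Qed.
Let q2 : 0 < 2 - q. Proof. by move: q1; lra. Qed.

(** Here K < M.  No second mesh is needed (X = 1), and about 144 K samples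
    bring the error down to eps/12.  With v = M^(1/q-1/2) eps/t > 1, the
    identity M/K = v^(2q/(2-q)) and 2q/(2-q) <= 2 give
    ln (1 + M/K) <= 2 ln (1 + v). *)
Lemma entropy_sparse : t * M%:R `^ (2^-1 - q^-1) < eps ->
  covered N (fun x => lqsum q x <= t `^ q) (eps / 6)
    ((2000 + 8 * C + 1200 * C1) * (t / eps) `^ (2 * q / (2 - q)) *
                    ln (1 + M%:R `^ (q^-1 - 2^-1) * t^-1 * eps)).
Proof.
move=> small; rewrite -/(sparse_dim q t eps).
have tauK := sparse_dim_meshq q1 e0 et.
have tau2 := sparse_dim_mesh2 q1 e0 et.
have K0 := sparse_dim_gt0 q e0 et.
have K1 := sparse_dim_ge1 q0 q1 e0 et.
have tau0 := sparse_mesh_gt0 q e0 et.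
set v := _ * t^-1 * eps.
have s0 : 0 < t / eps by rewrite divr_gt0.
have Mp0 : 0 < M%:R `^ (q^-1 - 2^-1) :> R by rewrite powR_gt0.
have vE : v = M%:R `^ (q^-1 - 2^-1) / (t / eps).
  by rewrite /v invfM invrK mulrA.
have v1 : 1 <= v.
  rewrite vE ler_pdivlMr// mul1r ler_pdivrMr//.
  move: small; rewrite (_ : 2^-1 - q^-1 = - (q^-1 - 2^-1)); last by ring.
  rewrite powRN ltr_pdivrMr// => /ltW; by rewrite mulrC.
have MK : M%:R / sparse_dim q t eps = v `^ (2 * q / (2 - q)).
  rewrite vE powRM ?(ltW Mp0) ?invr_ge0 ?(ltW s0)//.
  rewrite -[(t / eps)^-1]powR_inv1 ?(ltW s0)// -!powRrM mulN1r powRN.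
  rewrite /sparse_dim; congr (_ * _).
  rewrite (_ : _ * _ = 1) ?powRr1//; field.
  by rewrite !gt_eqF.
have v0 : 0 < v by exact: lt_le_trans v1.
have r2 : 2 * q / (2 - q) <= 2 by rewrite ler_pdivrMr//; move: q1; lra.
have r0 : 0 <= 2 * q / (2 - q).
  by rewrite divr_ge0 ?mulr_ge0 ?(ltW q0) ?(ltW q2).
move: tauK tau2 K0 K1 tau0 MK.
move: (sparse_dim q t eps) (sparse_mesh q t eps).
move=> K tau tauK tau2 K0 K1 tau0 MK.
set l := ln (1 + M%:R / K).
have lv : l <= 2 * ln (1 + v).
  apply: ln_le_2ln1D; rewrite ?(ltW v0)//.
    by rewrite ltr_pwDl// divr_ge0 ?(ltW K0).
  have : M%:R / K <= v ^+ 2.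
    by rewrite MK -powR_mulrn ?(ltW v0)// ler_powR.
  by move: v0; nra.
(* This lower bound turns the constants 1 + C and 1 + C1 into multiples of
   ln (1 + v). *)
have lv2 : 2^-1 <= ln (1 + v) by exact: ln1D_ge_half.
(* The squared error (K tau)^2 / n = K eps^2 / n has to be at most
   (eps / 12)^2. *)
pose n := (Num.truncn (144 * K)).+1.
have := truncn_itv (mulr_ge0 (ler0n _ 144) (ltW K0)).
rewrite -/n => /andP[nK Kn].
have nK1 : n%:R <= 145 * K :> R by rewrite /n -natr1; move: nK K1; lra.
have Kn1 : K <= n%:R by move: Kn K0; rewrite -/n; lra.
have n0 : 0 < n%:R :> R by rewrite ltr0n.
have d0 : 0 <= eps / 12 by rewrite divr_ge0// ltW.
have := @cover_nonneg R M N hN q C C1 tau K (K * tau) (eps / 12) 1 n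
  q0 cq c1 tau0 K0 isT isT _ d0.
rewrite divr1 tauK ln1 mulr0 addr0 => H.
have [||I [c [cE cP]]] := cover_signed hN q0 (H _ _).
- move=> x y yK xy xtau; apply: le_trans (sum_le_threshold q0 q1 xtau xy) _.
  apply: le_trans (ler_wpM2l (powR_ge0 _ _) yK) _.
  by rewrite -tauK mulrCA powR_1BqMq// ltW.
- have -> : (K * tau) ^+ 2 = K * eps ^+ 2 by rewrite -tau2; ring.
  have : K * eps ^+ 2 <= n%:R / 144 * eps ^+ 2.
    by rewrite ler_wpM2r ?sqr_ge0// ler_pdivlMr//; move: Kn; rewrite -/n; lra.
  rewrite exprMn; lra.
exists I, c; split; last first.
  move=> x /cP [i ci]; exists i; move: ci; lra.
apply: le_trans cE _; rewrite ler_expR.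
have ln_n : ln (1 + M%:R / n%:R) <= l.
  rewrite ler_ln ?posrE ?ltr_pwDl ?divr_ge0 ?(ltW K0)// lerD2l.
  by rewrite ler_wpM2l// lef_pV2.
have l0 : 0 <= ln (1 + M%:R / n%:R) :> R.
  by rewrite ln_ge0// lerDl divr_ge0.
have B1 : n%:R * (1 + C1 + ln (1 + M%:R / n%:R)) <= 145 * K * (1 + C1 + l).
  apply: ler_pM => //; first by move: C10 l0; lra.
  by rewrite lerD2l.
have B2 : K * (1 + C + l) + 145 * K * (1 + C1 + l) <=
    K * (1000 + 4 * C + 600 * C1) * ln (1 + v).
  rewrite (_ : _ + _ = K * ((1 + C + l) + 145 * (1 + C1 + l))); last by ring.
  rewrite -[leRHS]mulrA ler_wpM2l ?(ltW K0)//.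
  move: (ln (1 + v)) lv lv2 => b lv lv2.
  have : C * 2^-1 <= C * b by rewrite ler_wpM2l ?(ltW C0).
  have : C1 * 2^-1 <= C1 * b by rewrite ler_wpM2l ?(ltW C10).
  move: C0 C10; lra.
apply: le_trans (_ : 2 * (K * (1 + C + l) + 145 * K * (1 + C1 + l)) <= _).
  by rewrite ler_wpM2l// lerD2l.
apply: le_trans (ler_wpM2l _ B2) _ => //.
by rewrite le_eqVlt; apply/orP; left; apply/eqP; ring.
Qed.

(** Here all M coordinates matter.  The first mesh t M^(-1/q) is the one for
    which the count K equals M; the second one divides it by an integer X of
    the order of Y = M^(1/2-1/q) t/eps, at the cost M ln X, and 144 M samples
    then suffice. *)
Lemma entropy_dense : eps <= t * M%:R `^ (2^-1 - q^-1) ->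
  covered N (fun x => lqsum q x <= t `^ q) (eps / 6)
    ((2000 + 8 * C + 1200 * C1) * M%:R *
       ln (1 + M%:R `^ (2^-1 - q^-1) * t / eps)).
Proof.
move=> large; set Y := _ * t / eps.
have Y1 : 1 <= Y by rewrite ler_pdivlMr// mul1r mulrC.
have Y0 : 0 < Y by exact: lt_le_trans Y1.
pose tau := t * M%:R `^ (- q^-1).
have tau0 : 0 < tau by rewrite mulr_gt0 ?powR_gt0.
have tauK : M%:R * tau `^ q = t `^ q.
  rewrite powRM ?powR_ge0 ?(ltW t0)// -powRrM mulNr mulVf ?gt_eqF//.
  by rewrite powR_inv1 ?(ltW MR)// mulrCA mulfV ?mulr1// gt_eqF.
have tau2 : M%:R * tau ^+ 2 = eps ^+ 2 * Y ^+ 2.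
  have eY : eps * Y = M%:R `^ (2^-1 - q^-1) * t.
    by rewrite /Y mulrC divfK ?gt_eqF.
  have eM : M%:R * (M%:R `^ (- q^-1)) ^+ 2 = (M%:R `^ (2^-1 - q^-1)) ^+ 2 :> R.
    rewrite -[M%:R in X in X * _]powRr1 ?(ltW MR)//.
    rewrite -!powR_mulrn ?powR_ge0// -!powRrM -powRD.
      by congr (_ `^ _); field; rewrite gt_eqF.
    by rewrite (gt_eqF MR) implybT.
  by rewrite -exprMn eY [RHS]exprMn -eM /tau; ring.
pose X := (Num.truncn Y).+1.
have := truncn_itv (ltW Y0); rewrite -/X => /andP[XY YX].
have X0 : 0 < X%:R :> R by rewrite ltr0n.
have XY2 : X%:R <= 2 * Y by rewrite /X -natr1; move: XY Y1; lra.
have d0 : 0 <= eps / 12 by rewrite divr_ge0// ltW.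
have n0 : (0 < 144 * M)%N by rewrite muln_gt0.
have := @cover_nonneg R M N hN q C C1 tau M%:R (M%:R * (tau / X%:R)) (eps / 12)
  X (144 * M) q0 cq c1 tau0 MR isT n0 _ d0.
rewrite tauK => H.
have [||I [c [cE cP]]] := cover_signed hN q0 (H _ _).
- move=> x y _ _ xX; apply: le_trans (ler_sum _ (fun j _ => xX j)) _.
  by rewrite sumr_const card_ord mulr_natl.
- have -> : (M%:R * (tau / X%:R)) ^+ 2 = M%:R * (eps ^+ 2 * Y ^+ 2) / X%:R ^+ 2.
    by rewrite -tau2; field; rewrite gt_eqF.
  rewrite natrM ler_pdivrMr ?exprn_gt0//.
  have YX2 : Y ^+ 2 <= X%:R ^+ 2.
    by rewrite lerXn2r ?nnegrE ?(ltW Y0) ?(ltW X0)// ltW.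
  have : M%:R * eps ^+ 2 * Y ^+ 2 <= M%:R * eps ^+ 2 * X%:R ^+ 2.
    by rewrite ler_wpM2l// mulr_ge0 ?sqr_ge0.
  rewrite [(eps / 12) ^+ 2]exprMn; lra.
exists I, c; split; last first.
  move=> x /cP [i ci]; exists i; move: ci; lra.
apply: le_trans cE _; rewrite ler_expR.
have lY2 : 2^-1 <= ln (1 + Y) by exact: ln1D_ge_half.
have lX : ln X%:R <= 2 * ln (1 + Y).
  by apply: ln_le_2ln1D; rewrite ?(ltW Y0)//; move: XY2 Y0; nra.
have l1 : ln (1 + M%:R / M%:R) <= 1 :> R.
  by rewrite divff ?gt_eqF//; apply: le_ln1Dx; lra.
have l2 : ln (1 + M%:R / (144 * M)%:R) <= 1 :> R.
  apply: le_trans (le_ln1Dx _) _; last first.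
    by rewrite ler_pdivrMr ?ltr0n// mul1r ler_nat leq_pmull.
  by apply: lt_le_trans (_ : 0 <= _); [lra|rewrite divr_ge0].
move: (ln (1 + M%:R / M%:R)) (ln (1 + M%:R / (144 * M)%:R)) l1 l2 => a b l1 l2.
move: (ln (1 + Y)) (ln X%:R) lY2 lX => y x lY2 lX; rewrite natrM.
have -> : 2 * (M%:R * (1 + C + a) + M%:R * x + 144%:R * M%:R * (1 + C1 + b)) =
    M%:R * (2 * (1 + C + a + x + 144 * (1 + C1 + b))) by ring.
rewrite (mulrC _ M%:R) -mulrA ler_wpM2l ?(ltW MR)//.
have : C * 2^-1 <= C * y by rewrite ler_wpM2l ?(ltW C0).
have : C1 * 2^-1 <= C1 * y by rewrite ler_wpM2l ?(ltW C10).
move: C0 C10; lra.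
Qed.

End Bound.
End Entropy.

(** * Nets of sparse points, and sparse minimisers *)

Section Net.
Context (R : realType) (M : nat) (N : 'rV[R]_M -> R).
Hypothesis hN : hilbertian_seminorm N.
Variables (q t eps : R).
Hypotheses (q0 : 0 < q) (q1 : q <= 1) (e0 : 0 < eps) (et : eps < t).
Let t0 : 0 < t := lt_trans e0 et.
Implicit Types x y : 'rV[R]_M.

(** [sparse_approx] with the threshold tau/5: it costs a factor 5^q <= 5 in
    the number of coefficients and leaves a squared error of at most
    2 eps^2/5 < (2 eps/3)^2. *)
Lemma sparse_in_ball x : lqsum q x <= t `^ q ->
  exists x', [/\ lqsum q x' <= t `^ q,
    (l0norm x')%:R <= 5 * sparse_dim q t eps & N (x' - x) <= 2 / 3 * eps].
Proof.
move=> xt.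
have tauK := sparse_dim_meshq q1 e0 et.
have tau2 := sparse_dim_mesh2 q1 e0 et.
have K0 := sparse_dim_gt0 q e0 et.
have tau0 := sparse_mesh_gt0 q e0 et.
move: tauK tau2 K0 tau0.
move: (sparse_dim q t eps) (sparse_mesh q t eps) => K tau tauK tau2 K0 tau0.
have t50 : 0 < tau / 5 by rewrite divr_gt0.
have [x' [x'x x'0 x'd]] := sparse_approx hN x q0 q1 t50.
exists x'; split; first exact: le_trans xt.
  have tq0 : 0 < (tau / 5) `^ q by rewrite powR_gt0.
  rewrite -(ler_pM2r tq0); apply: le_trans x'0 _; apply: le_trans xt _.
  rewrite -tauK (mulrC 5) -mulrA ler_wpM2l ?(ltW K0)//.
  have {1}-> : tau = 5 * (tau / 5) by rewrite mulrCA divff ?mulr1.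
  rewrite powRM ?(ltW t50)// ler_wpM2r ?powR_ge0//.
  by rewrite ler1_powR// ler1n.
rewrite -(@ler_pXn2r _ 2) ?nnegrE ?(hs_ge0 hN) ?mulr_ge0 ?(ltW e0)//.
apply: le_trans x'd _.
have h : (tau / 5) `^ (2 - q) * lqsum q x <= 5^-1 * eps ^+ 2.
  apply: le_trans (ler_wpM2l (powR_ge0 _ _) xt) _.
  have tt : tau `^ (2 - q) * tau `^ q = tau ^+ 2.
    rewrite -powRD; last by rewrite (gt_eqF tau0) implybT.
    by rewrite subrK powR_mulrn// ltW.
  rewrite powRM ?(ltW tau0)// -tauK -tau2 -tt.
  rewrite (_ : _ * (K * _) =
    5^-1 `^ (2 - q) * (K * (tau `^ (2 - q) * tau `^ q))); last by ring.
  rewrite ler_wpM2r ?mulr_ge0 ?powR_ge0 ?(ltW K0)// ge1r_powR//.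
    by apply/andP; split; lra.
  by move: q1; lra.
rewrite -mulrA; apply: le_trans (ler_wpM2l _ h) _ => //.
rewrite exprMn mulrA ler_wpM2r ?sqr_ge0//; lra.
Qed.

(** In each cell that contains a sparse point of the ball, one such point is
    selected; the other cells are assigned 0.  A point of the ball is moved to
    a sparse one (2 eps/3), then to the selected point of the same cell
    (2 eps/6). *)
Lemma exists_sparse_net E :
  covered N (fun x => lqsum q x <= t `^ q) (eps / 6) E ->
  exists (n : nat) (theta : 'I_n -> 'rV[R]_M),
    [/\ forall i, lqsum q (theta i) <= t `^ q,
        forall i, (l0norm (theta i))%:R <= 5 * sparse_dim q t eps,
        forall x, lqsum q x <= t `^ q -> exists i, N (x - theta i) <= eps &
        ln n%:R <= E].
Proof.
move=> [I [c [cE cP]]].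
have K0 := sparse_dim_gt0 q e0 et.
(* The point 0 satisfies P: it serves the cells without a sparse point. *)
pose P x := lqsum q x <= t `^ q /\ (l0norm x)%:R <= 5 * sparse_dim q t eps.
have P0 : P 0.
  split.
    rewrite /lqsum big1 ?powR_ge0// => j _.
    by rewrite mxE normr0 powR0// gt_eqF.
  by rewrite /l0norm big1 ?mulr_ge0 ?(ltW K0)// => j _; rewrite mxE eqxx.
have /choice[e eP] : forall i, exists y, P y /\
    forall x, P x -> N (c i - x) <= eps / 6 -> N (c i - y) <= eps / 6.
  move=> i.
  have [[y [Py yc]]|no] := pselect (exists y, P y /\ N (c i - y) <= eps / 6).
    by exists y.
  exists 0; split => // x Px xc; exfalso; apply: no; by exists x.
have I0 : (0 < #|I|)%N.
  have [i _] := cP 0 P0.1; by apply/card_gt0P; exists i.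
exists #|I|, (fun i => e (enum_val i)); split.
- by move=> i; exact: (eP _).1.1.
- by move=> i; exact: (eP _).1.2.
- move=> x xt; have [x' [x't x'0 x'x]] := sparse_in_ball xt.
  have [i ci] := cP x' x't.
  have ei := (eP i).2 x' (conj x't x'0) ci.
  exists (enum_rank i); rewrite enum_rankK.
  have -> : x - e i = - (x' - x) + ((c i - e i) - (c i - x')).
    by apply/rowP => j; rewrite !mxE; ring.
  apply: le_trans (hs_triangle hN _ _) _; rewrite (hs_opp hN).
  have := hs_triangle hN (c i - e i) (- (c i - x')); rewrite (hs_opp hN).
  move: ei ci x'x; lra.
- by rewrite -(expRK E) ler_ln ?posrE ?expR_gt0// ltr0n.
Qed.

End Net.

Section Risk.
Context (R : realType) (M : nat) (risk Q : 'rV[R]_M -> R).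
Hypothesis riskQ : quadratic_expansion risk Q.
Hypothesis Q_ge0 : forall v, 0 <= Q v.
Hypothesis Q_axis : forall a j, Q (a *: delta_mx 0 j) <= a ^+ 2.

(** The inequality in the definition of [big_part] is strict, which excludes
    n + 1 large coefficients in the extreme case. *)
Lemma l0norm_big_part q tau (x : 'rV[R]_M) (n : nat) : 0 < q -> 0 < tau ->
  lqsum q x <= n.+1%:R * tau `^ q -> (l0norm (big_part tau x) <= n)%N.
Proof.
move=> q0 tau0 xn; rewrite leqNgt; apply/negP => nl.
have tq0 : 0 < tau `^ q by rewrite powR_gt0.
pose B := [pred j | tau < `|x ord0 j|].
have lE : l0norm (big_part tau x) = #|B|.
  rewrite -sum1_card [RHS]big_mkcond; apply: eq_bigr => j _; rewrite mxE inE.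
  case: ifP => [h|_]; last by rewrite eqxx.
  have -> // : x ord0 j != 0.
  by apply: contraTneq h => ->; rewrite normr0 -leNgt ltW.
have /card_gt0P[j0 Bj0] : (0 < #|B|)%N by rewrite -lE; exact: leq_trans nl.
have Blt j : B j -> tau `^ q < `|x ord0 j| `^ q.
  by move=> Bj; rewrite gt0_ltr_powR ?nnegrE ?(ltW tau0).
have : \sum_(j | B j) tau `^ q < \sum_(j | B j) `|x ord0 j| `^ q.
  rewrite (bigD1 j0)//= [ltRHS](bigD1 j0)//= ltr_leD ?Blt//.
  by apply: ler_sum => j /andP[/Blt/ltW].
apply/negP; rewrite -leNgt sumr_const -mulr_natl.
apply: le_trans (_ : lqsum q x <= _).
  rewrite /lqsum [leRHS](bigID B)/= lerDl; apply: sumr_ge0 => j _.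
  exact: powR_ge0.
apply: le_trans xn _; rewrite ler_wpM2r ?(ltW tq0)// ler_nat.
by rewrite -lE.
Qed.

(** The coefficients above t (a+1)^(-1/q), of which there are at most a, are
    kept, and the rest is replaced by k samples.  The samples use the exact l_1 norm L of the rest, so that the
    l_1 norm does not increase. *)
Lemma sparse_risk q t (x : 'rV[R]_M) (a k : nat) : 0 < q -> q <= 1 -> 0 < t ->
  (0 < k)%N -> lqsum q x <= t `^ q ->
  exists x', [/\ (l0norm x' <= a + k)%N, \sum_j `|x' ord0 j| <= t &
    risk x' <= risk x + (t * a.+1%:R `^ (1 - q^-1)) ^+ 2 / k%:R].
Proof.
move=> q0 q1 t0 k0 xt.
have aR : 0 < a.+1%:R :> R by rewrite ltr0n.
have kR : 0 < k%:R :> R by rewrite ltr0n.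
pose tau := t * a.+1%:R `^ (- q^-1).
have tau0 : 0 < tau by rewrite mulr_gt0 ?powR_gt0.
have tauq : a.+1%:R * tau `^ q = t `^ q.
  rewrite powRM ?powR_ge0 ?(ltW t0)// -powRrM mulNr mulVf ?gt_eqF//.
  by rewrite powR_inv1 ?(ltW aR)// mulrCA mulfV ?mulr1// gt_eqF.
set y := big_part tau x; set u := small_part tau x.
have yu : y + u = x := big_small_part tau x.
set L := \sum_j `|u ord0 j|.
have L0 : 0 <= L by exact: sumr_ge0.
have LE : L <= t * a.+1%:R `^ (1 - q^-1).
  have ux j : `|u ord0 j| <= `|x ord0 j|.
    by rewrite mxE; case: ifP; rewrite ?normr0.
  have ut j : `|u ord0 j| <= tau by rewrite small_part_le// ltW.
  apply: le_trans (sum_le_threshold q0 q1 ut ux) _.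
  apply: le_trans (ler_wpM2l (powR_ge0 _ _) xt) _.
  rewrite powRM ?powR_ge0 ?(ltW t0)// mulrAC powR_1BqMq ?(ltW t0)//.
  rewrite -powRrM (_ : - q^-1 * (1 - q) = 1 - q^-1)//; field; by rewrite gt_eqF.
have [m [m0 mk rm]] := maurey riskQ Q_ge0 Q_axis y k0 (lexx L).
exists (y + steps_towards u (L / k%:R) m); split.
- apply: leq_trans (_ : l0norm y + \sum_j m j <= _)%N; last first.
    by rewrite leq_add// (l0norm_big_part q0)// tauq.
  rewrite /l0norm -big_split /=; apply: leq_sum => j _; rewrite mxE.
  have [yj|_] := eqVneq (y ord0 j) 0; last by case: (_ != 0).
  rewrite yj add0r mxE; case: (m j) => [|b]; first by rewrite mulr0 eqxx.
  by case: (_ != 0).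
- apply: le_trans (_ : \sum_j (`|y ord0 j| + `|u ord0 j|) <= _); last first.
    apply: le_trans (lqsum_le_l1 q0 q1 t0 xt); apply: ler_sum => j _.
    by rewrite !mxE; case: ifP; rewrite normr0 ?addr0 ?add0r.
  rewrite big_split /=.
  apply: le_trans (_ : \sum_j (`|y ord0 j| + L / k%:R * (m j)%:R) <= _).
    apply: ler_sum => j _; rewrite mxE; apply: le_trans (ler_normD _ _) _.
    rewrite lerD2l mxE !normrM normr_nat ger0_norm//.
    rewrite ger0_norm ?invr_ge0// normr_sg ler_wpM2r// ler_piMr ?divr_ge0//.
    by case: (_ != 0).
  rewrite big_split /= lerD2l -mulr_sumr -natr_sum.
  by rewrite mulrAC ler_pdivrMr// ler_wpM2l// ler_nat.
apply: le_trans rm _; rewrite yu lerD2l ler_wpM2r ?invr_ge0//.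
by rewrite lerXn2r ?nnegrE ?mulr_ge0 ?powR_ge0 ?(ltW t0).
Qed.

End Risk.

(** With a = (m-1)/2 rounded down, a + 1 >= m/2 and m - a > m/2; the second
    inequality is always strict, even for q = 1 and m even. *)
Lemma sparse_risk_bound (R : realType) (q t : R) (m : nat) :
  0 < q -> q <= 1 -> 0 < t -> (0 < m)%N ->
  (t * (m.-1)./2.+1%:R `^ (1 - q^-1)) ^+ 2 / (m - (m.-1)./2)%:R <
  2 `^ (2 / q - 1) * t ^+ 2 * m%:R `^ (1 - 2 / q).
Proof.
move=> q0 q1 t0 m0.
have mR : 0 < m%:R :> R by rewrite ltr0n.
have h0 : 0 < m%:R / 2 :> R by rewrite divr_gt0.
set a := (m.-1)./2.+1; set k := (m - _)%N.
have ma : m%:R / 2 <= a%:R :> R.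
  rewrite ler_pdivrMr// -natrM ler_nat /a; lia.
have mk : m%:R / 2 < k%:R :> R.
  rewrite ltr_pdivrMr// -natrM ltr_nat /k; lia.
have k0 : 0 < k%:R :> R by exact: lt_trans mk.
have a0 : 0 < a%:R :> R by rewrite ltr0n.
have iq : 1 <= q^-1 by rewrite invf_ge1.
have -> : 2 `^ (2 / q - 1) * t ^+ 2 * m%:R `^ (1 - 2 / q) =
    t ^+ 2 * (m%:R / 2) `^ (1 - 2 / q).
  rewrite mulrAC mulrC; congr (_ * _).
  rewrite powRM ?(ltW mR) ?invr_ge0// mulrC; congr (_ * _).
  rewrite -[2^-1]powR_inv1// -powRrM; congr (_ `^ _); ring.
rewrite exprMn -mulrA ltr_pM2l ?exprn_gt0//.
rewrite -powR_mulrn ?powR_ge0// -powRrM.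
apply: le_lt_trans (_ : (m%:R / 2) `^ ((1 - q^-1) * 2) / k%:R < _).
  rewrite ler_wpM2r ?invr_ge0 ?(ltW k0)//.
  rewrite (_ : (1 - q^-1) * 2 = - ((q^-1 - 1) * 2)); last by ring.
  rewrite !powRN lef_pV2 ?posrE ?powR_gt0//.
  rewrite ge0_ler_powR ?nnegrE ?(ltW h0) ?(ltW a0)// mulr_ge0// subr_ge0//.
rewrite (_ : (1 - q^-1) * 2 = (1 - 2 / q) + 1); last by ring.
rewrite powRD; last by rewrite (gt_eqF h0) implybT.
rewrite powRr1 ?(ltW h0)// -mulrA gtr_pMr ?powR_gt0//.
by rewrite ltr_pdivrMr// mul1r.
Qed.

Lemma exists_superset (T : finType) (A : {set T}) (m : nat) :
  (#|A| <= m <= #|T|)%N -> exists2 J : {set T}, A \subset J & #|J| = m.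
Proof.
move=> /andP[Am mT].
elim: m Am mT => [|m IH] Am mT.
  by exists A => //; apply/eqP; rewrite -leqn0.
move: Am; rewrite leq_eqVlt => /orP[/eqP Am|]; first by exists A.
rewrite ltnS => Am; have [J AJ Jm] := IH Am (ltnW mT).
have /card_gt0P[x] : (0 < #|~: J|)%N.
  by rewrite -(ltn_add2l #|J|) cardsC addn0 Jm.
rewrite inE => xJ; exists (x |: J); last by rewrite cardsU1 xJ Jm.
exact: fintype.subset_trans AJ (finset.subsetUr _ _).
Qed.

Lemma L2norm_seminorm (R : realType) d (T : measurableType d)
    (nu : {measure set T -> \bar R}) (M : nat) (f : 'I_M -> T -> R) :
  (forall j, f j \in Lfun nu 2%:E) -> (forall j, L2norm nu (f j) <= 1) ->
  hilbertian_seminorm (fun x => L2norm nu (lincomb f x)).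
Proof.
move=> fL2 f1; split.
- by move=> x; exact: L2norm_ge0.
- by move=> x y; rewrite lincombD L2norm_add// lincomb_L2.
- move=> x; rewrite lincombN /L2norm; congr fine.
  rewrite (_ : _ \o _ = \- (EFin \o lincomb f x))%E//.
  exact: oppe_Lnorm.
- by move=> a j; rewrite L2norm_scale_delta// ler_piMr.
- move=> y.
  have z2 : (fun=> 0) \in Lfun nu 2%:E.
    exact: (proj1 (Lfun_addr_closed nu (le1_2e R))).
  have [g gE] := L2norm_expand fL2 z2 y; exists g => v.
  have z x : lincomb f x \- (fun=> 0) = lincomb f x.
    by apply/funext => s; rewrite /= subr0.
  by rewrite -[lincomb f (y + v)]z -[lincomb f y]z gE.
Qed.

Theorem theorem1 (R : realType) :
  (forall q : R, 0 < q -> q <= 1 ->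
    exists2 c : R, 0 < c &
      forall (d : measure_display) (T : measurableType d)
        (nu : {sigma_finite_measure set T -> \bar R})
        (M : nat) (f : 'I_M -> T -> R) (t eps : R),
        (2 <= M)%N ->
        (forall j, f j \in Lfun nu 2%:E) ->
        (forall j, L2norm nu (f j) <= 1) ->
        0 < eps -> eps < t ->
        exists (N : nat) (theta : 'I_N -> 'rV[R]_M),
          [/\ forall i, lqnorm q (theta i) <= t,
              is_eps_net nu (lqhull f q t) eps (fun i => lincomb f (theta i)),
              forall i, (l0norm (theta i))%:R <=
                5 * (t / eps) `^ (2 * q / (2 - q)) + 1 &
              ln N%:R <=
                if t * M%:R `^ (2^-1 - q^-1) < eps then
                  c * (t / eps) `^ (2 * q / (2 - q)) *
                    ln (1 + M%:R `^ (q^-1 - 2^-1) * t^-1 * eps)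
                else
                  c * M%:R * ln (1 + M%:R `^ (2^-1 - q^-1) * t / eps)])
  /\
  (forall (d : measure_display) (T : measurableType d)
      (nu : {sigma_finite_measure set T -> \bar R})
      (M : nat) (f : 'I_M -> T -> R) (m : nat) (q t : R) (f0 : T -> R),
      (2 <= M)%N ->
      (forall j, f j \in Lfun nu 2%:E) ->
      (forall j, L2norm nu (f j) <= 1) ->
      (1 <= m <= M)%N -> 0 < q -> q <= 1 -> 0 < t ->
      f0 \in Lfun nu 2%:E ->
      exists (J : {set 'I_M}) (theta : 'rV[R]_M),
        [/\ #|J| = m, supported_in J theta, lqnorm 1 theta <= t &
            L2norm nu (lincomb f theta \- f0) ^+ 2 -
              dist2 nu f0 (lqhull f q t) <=
            2 `^ (2 / q - 1) * t ^+ 2 * m%:R `^ (1 - 2 / q)]).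
Proof.
split=> [q q0 q1|].
  have [C C0 cq] := count_nat_vectors q0.
  have [C1 C10 c1] := count_nat_vectors (@ltr01 R).
  exists (2000 + 8 * C + 1200 * C1).
    by move: C0 C10; lra.
  move=> d T nu M f t eps M2 fL2 f1 e0 et.
  have hN := L2norm_seminorm fL2 f1.
  have M0 : (0 < M)%N := ltnW M2.
  have t0 : 0 < t := lt_trans e0 et.
  have [|n [theta [thq thl thn thE]]] := exists_sparse_net hN q0 q1 e0 et
      (E := if t * M%:R `^ (2^-1 - q^-1) < eps then
              (2000 + 8 * C + 1200 * C1) * (t / eps) `^ (2 * q / (2 - q)) *
                ln (1 + M%:R `^ (q^-1 - 2^-1) * t^-1 * eps)
            else
              (2000 + 8 * C + 1200 * C1) * M%:R *
                ln (1 + M%:R `^ (2^-1 - q^-1) * t / eps)).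
    case: ltP => [small|large].
      exact: (entropy_sparse hN M0 q0 q1 e0 et C0 C10 cq c1 small).
    exact: (entropy_dense hN M0 q0 e0 et C0 C10 cq c1 large).
  exists n, theta; split => //.
  - by move=> i; rewrite lqnorm_le// ltW.
  - split=> [i|g [x /= xt <-]].
      by exists (theta i) => //=; rewrite lqnorm_le// ltW.
    have [|i xi] := thn x; first by rewrite -lqnorm_le// ltW.
    by exists i; rewrite -lincombB.
  - by move=> i; apply: le_trans (thl i) _; rewrite lerDl.
move=> d T nu M f m q t f0 M2 fL2 f1 /andP[m0 mM] q0 q1 t0 f0L2.
have hN := L2norm_seminorm fL2 f1.
pose risk (x : 'rV[R]_M) := L2norm nu (lincomb f x \- f0) ^+ 2.
pose a := (m.-1)./2; pose k := (m - a)%N.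
have ak : (a + k = m)%N by rewrite /k subnKC// /a; lia.
have k0 : (0 < k)%N by rewrite /k /a; lia.
have gap := sparse_risk_bound q0 q1 t0 m0; rewrite -/a -/k in gap.
set err := (t * _) ^+ 2 / _ in gap; set bound := 2 `^ _ * _ * _ in gap *.
set S := [set L2norm nu (h \- f0) ^+ 2 | h in lqhull f q t].
have infS : has_inf S.
  split; last by exists 0 => _ [h _ <-]; exact: sqr_ge0.
  exists (risk 0); exists (lincomb f 0) => //; exists 0 => //=.
  rewrite lqnorm_le ?(ltW t0)// /lqsum big1 ?powR_ge0// => j _.
  by rewrite mxE normr0 powR0// gt_eqF.
(* A point of the ball whose risk exceeds the infimum by less than the margin
   bound - err. *)
have [|_ [_ [x /= xt <-] <-] xinf] := @inf_adherent _ S (bound - err) _ infS.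
  by rewrite subr_gt0.
have [x' [x'l x'1 x'r]] := sparse_risk (L2norm_expand fL2 f0L2)
  (fun v => sqr_ge0 _) (hs_axis_sqr hN) a q0 q1 t0 k0
  (etrans (esym (lqnorm_le x q0 (ltW t0))) xt).
rewrite ak in x'l.
have [|J supJ Jm] := @exists_superset _ [set j | x' ord0 j != 0]%SET m.
  rewrite card_ord mM andbT; apply: leq_trans x'l.
  rewrite -sum1_card big_mkcond; apply: leq_sum => j _; rewrite finset.inE.
  by case: (_ != 0).
exists J, x'; split; [exact: Jm| | |].
- move=> j; apply: contraNeq => xj0; apply: (fintype.subsetP supJ).
  by rewrite finset.inE.
- rewrite lqnorm_le ?(ltW t0)// powRr1 ?(ltW t0)//.
  by rewrite /lqsum; under eq_bigr do rewrite powRr1//.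
move: xinf x'r; rewrite /dist2 -/S -/(risk x) -/(risk x') -/err; lra.
Qed.
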